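(* Let $n\ge 3$, let $\mathcal B$ be an $n$-dimensional manifold (possibly with boundary and corners) with an affine structure with focus points, and let $O\in\mathcal B$ be a focus point with exactly one focus component and index $k>0$, with a local multi-valued affine coordinate system $(F,G,L_1,\dots,L_{n-2})$ (with branches $G_l,G_r$ of $G$) such that $F(O)=G(O)=L_1(O)=\dots=L_{n-2}(O)=0$. Then every $n$-dimensional focus box around $O$ is convex.
   Context: Affine structure near a focus point with one focus component. A singular affine manifold $\mathcal B$ carries a sheaf of smooth functions (local affine functions, stable under real linear combinations and containing the constants); near each point of an open dense set (the regular points) there are $n$ affine functions which form local coordinates and which, together with constants, span the affine functions. Near a focus point $O$ with one focus component there are a neighborhood $V$, single-valued affine functions $F,L_1,\dots,L_{n-2}$ and a smooth function $H$ such that $(F,H,L_1,\dots,L_{n-2})$ are smooth coordinates on $V$; the set of focus points in $V$ is the codimension-two submanifold $\mathcal S=\{F=H=0\}$; and there are two continuous functions $G_l,G_r$ on $V$ (branches of a multi-valued function $G$) such that $G_l$ is affine on $V\setminus\{F=0,H\ge0\}$, $G_r$ is affine on $V\setminus\{F=0,H\le0\}$, $G_l=G_r=:G$ when $F\le0$, $G_r=G_l+kF$ when $F\ge0$ (with a constant $k>0$, the index), and $\partial G_l/\partial H=\partial G_r/\partial H>0$ off $\mathcal S$. On the regular part, $(F,G_l,L_1,\dots,L_{n-2})$ or $(F,G_r,L_1,\dots,L_{n-2})$ (where affine) are affine coordinates. This is a multi-valued affine coordinate system. The point $O$ may lie on the boundary of $\mathcal B$; in that case $\mathcal B$ is assumed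 to come from an integrable Hamiltonian system with only non-degenerate elliptic and focus-focus components, and, if $O$ has $e$ elliptic components, one takes $L_1,\dots,L_e$ to be the corresponding action functions, so that near $O$ the manifold $\mathcal B$ is given by $L_1\ge0,\dots,L_e\ge0$. Focus box. A focus box around $O$ is the set of all $x$ in a neighborhood of $O$ satisfying $-\delta\le F(x)\le\delta$, $-\delta'\le G_l(x)$, $G_r(x)\le\delta'$, and $-\delta_i\le L_i(x)\le\delta_i$ for $i=1,\dots,n-2$ (for boundary points with $e$ elliptic components the conditions for $i\le e$ read $0\le L_i(x)\le\delta_i$), where $\delta,\delta',\delta_1,\dots,\delta_{n-2}$ are arbitrary sufficiently small positive numbers. Straight lines. A curve is a continuous map from an interval to $\mathcal B$. A regular straight line is a curve in the regular part that is affine in every local affine chart. A singular straight line is a non-constant parametrized continuous curve $\gamma:I\to\mathcal B$ containing focus points such that every $t_0$ in the interior of $I$ has a neighborhood $[s,t]\subset I$ on which $\gamma$ is a (uniform) limit of affinely parametrized regular straight lines $\gamma_n:[s,t]\to\mathcal B$. A straight line is a regular or a singular straight line. Convexity. A subset $C$ is convex if any two points of $C$ can be joined by at least one (regular or singular) straight line contained in $C$. *)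

(* Defs.v *)
From HB Require Import structures.
From mathcomp Require Import all_boot all_order all_algebra.
From mathcomp Require Import all_classical all_reals all_analysis.

Set Implicit Arguments.
Unset Strict Implicit.
Unset Printing Implicit Defensive.
Import Order.TTheory GRing.Theory Num.Theory.
Import numFieldNormedType.Exports.
Local Open Scope classical_set_scope.
Local Open Scope ring_scope.

Definition partials (R : realType) (n : nat) (s : seq 'I_n)
    (g : 'rV[R]_n -> R) : 'rV[R]_n -> R :=
  foldr (fun (i : 'I_n) (h : 'rV[R]_n -> R) => 'D_(delta_mx 0 i) h) g s.

Definition smooth_near (R : realType) (n : nat) (g : 'rV[R]_n -> R)
    (p : 'rV[R]_n) : Prop :=
  \forall q \near p, forall s : seq 'I_n,
    {for q, continuous (partials s g)} /\
    (forall i : 'I_n, derivable (partials s g) q (delta_mx 0 i)).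

Definition corner (R : realType) (n : nat) (J : {set 'I_n}) : set 'rV[R]_n :=
  [set p | forall i, i \in J -> 0 <= p 0 i].
Arguments corner : clear implicits.

(* [phi] maps the open set [U] homeomorphically onto a relatively open subset
   of [D]. *)
Definition open_embedding_in (R : realType) (n : nat) (B : topologicalType)
    (D : set 'rV[R]_n) (U : set B) (phi : B -> 'rV[R]_n) : Prop :=
  [/\ open U,
      {in U &, injective phi},
      {within U, continuous phi} &
      forall W : set B, open W -> W `<=` U ->
        exists2 A : set 'rV[R]_n, open A & phi @` W = A `&` D].

(* [f] is, near [x], a smooth function of the coordinates [phi]. As usual on
   manifolds with corners, smoothness on a set that is not open in R^n means
   having a local smooth extension to R^n. *)
Definition smooth_function_of (R : realType) (n : nat) (B : topologicalType)
    (phi : B -> 'rV[R]_n) (f : B -> R) (x : B) : Prop :=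
  exists2 g : 'rV[R]_n -> R, smooth_near g (phi x) &
    \forall z \near x, f z = g (phi z).

Record corner_manifold (R : realType) (n : nat) (B : topologicalType) := {
  atlas : set (set B * (B -> 'rV[R]_n));
  manifold_hausdorff : hausdorff_space B;
  manifold_second_countable : @second_countable B;
  atlas_cover : forall x : B, exists2 c, atlas c & c.1 x;
  atlas_chart : forall c, atlas c ->
    exists J : {set 'I_n}, open_embedding_in (corner R n J) c.1 c.2;
  atlas_compat : forall c d x (i : 'I_n), atlas c -> atlas d -> c.1 x -> d.1 x ->
    smooth_function_of c.2 (fun z => d.2 z 0 i) x }.

Definition smooth_at (R : realType) (n : nat) (B : topologicalType)
    (M : corner_manifold R n B) (f : B -> R) (x : B) : Prop :=
  exists c, [/\ atlas M c, c.1 x & smooth_function_of c.2 f x].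

Definition smooth_coordinates (R : realType) (n : nat) (B : topologicalType)
    (M : corner_manifold R n B) (U : set B) (y : B -> 'rV[R]_n) : Prop :=
  open_embedding_in (y @` U) U y /\
  (forall x (i : 'I_n), U x ->
    smooth_at M (fun z => y z 0 i) x /\
    (forall c, atlas M c -> c.1 x ->
      smooth_function_of y (fun z => c.2 z 0 i) x)).

Section AffineCoordinates.
Context (R : realType) (n : nat) (B : topologicalType).
Variables (M : corner_manifold R n B) (aff : set B -> (B -> R) -> Prop).

(* [n] affine functions on [U] that are local coordinates and, together with
   the constants, span the germs of affine functions at the points of [U]. *)
Definition affine_coordinates_for (U : set B) (y : B -> 'rV[R]_n) : Prop :=
  [/\ smooth_coordinates M U y,
      forall i : 'I_n, aff U (fun z => y z 0 i) &
      forall (x : B) (W : set B) (f : B -> R),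
        U x -> open W -> W x -> aff W f ->
        exists (a0 : R) (a : 'I_n -> R),
          \forall z \near x, f z = a0 + \sum_(i < n) a i * y z 0 i].

Definition regular_points_for : set B :=
  [set x | exists U y, U x /\ affine_coordinates_for U y].

End AffineCoordinates.

(* [affine_on U f], for [U] open, says that [f] restricted to [U] is a section
   over [U] of the sheaf of local affine functions. *)
Record singular_affine_manifold (R : realType) (n : nat)
    (B : topologicalType) := {
  smooth_structure :> corner_manifold R n B;
  affine_on : set B -> (B -> R) -> Prop;
  affine_smooth : forall U f x, open U -> affine_on U f -> U x ->
    smooth_at smooth_structure f x;
  affine_restrict : forall U W f g, open U -> open W -> W `<=` U ->
    {in W, f =1 g} -> affine_on U f -> affine_on W g;
  affine_glue : forall U f, open U ->
    (forall x, U x -> exists W, [/\ open W, W x & affine_on W f]) ->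
    affine_on U f;
  affine_const : forall U (a : R), open U -> affine_on U (fun=> a);
  affine_lin : forall U f g (a b : R), open U -> affine_on U f ->
    affine_on U g -> affine_on U (fun z => a * f z + b * g z);
  regular_dense : dense (regular_points_for smooth_structure affine_on) }.

Definition affine_coordinates (R : realType) (n : nat) (B : topologicalType)
    (M : singular_affine_manifold R n B) (U : set B) (y : B -> 'rV[R]_n) : Prop :=
  affine_coordinates_for M (@affine_on _ _ _ M) U y.

Definition regular_points (R : realType) (n : nat) (B : topologicalType)
    (M : singular_affine_manifold R n B) : set B :=
  regular_points_for M (@affine_on _ _ _ M).

(* In an affine structure with focus points, the points that are not regular
   are the focus points. *)
Definition focus_points (R : realType) (n : nat) (B : topologicalType)
    (M : singular_affine_manifold R n B) : set B := ~` regular_points M.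

Definition coords (R : realType) (n : nat) (a b : R) (l : 'I_(n - 2) -> R) :
    'rV[R]_n :=
  \row_(j < n) match nat_of_ord j with
               | 0 => a
               | 1 => b
               | i.+2 => oapp l 0 (insub i)
               end.

(* The expression of [f] in the coordinates [phi] on [V] (0 off [phi @` V]),
   used to take partial derivatives with respect to these coordinates. *)
Definition local_expr (R : realType) (n : nat) (B : topologicalType)
    (V : set B) (phi : B -> 'rV[R]_n) (f : B -> R) : 'rV[R]_n -> R :=
  fun p => xget 0 [set r | exists z, [/\ V z, phi z = p & f z = r]].

Record multivalued_coords (R : realType) (n : nat) (B : topologicalType) := {
  mc_V : set B;
  mc_F : B -> R;
  mc_H : B -> R;
  mc_L : 'I_(n - 2) -> B -> R;
  mc_Gl : B -> R;
  mc_Gr : B -> R;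
  mc_k : R;   (* index *)
  mc_e : nat  (* number of elliptic components *) }.

Section FocusCoordinates.
Context (R : realType) (n : nat) (B : topologicalType).
Variables (M : singular_affine_manifold R n B) (c : multivalued_coords R n B).

Let V := mc_V c.
Let F := mc_F c.
Let H := mc_H c.
Let L := mc_L c.
Let Gl := mc_Gl c.
Let Gr := mc_Gr c.
Let k := mc_k c.
Let e := mc_e c.

Definition FHL (x : B) : 'rV[R]_n := coords (F x) (H x) (L ^~ x).
Definition FGlL (x : B) : 'rV[R]_n := coords (F x) (Gl x) (L ^~ x).
Definition FGrL (x : B) : 'rV[R]_n := coords (F x) (Gr x) (L ^~ x).

Definition dH : 'rV[R]_n := coords 0 1 (fun=> 0).

Definition left_domain : set B := V `\` [set x | F x = 0 /\ 0 <= H x].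
Definition right_domain : set B := V `\` [set x | F x = 0 /\ H x <= 0].

(* [L_1, ..., L_e] are the coordinates of [FHL] with indices 2, ..., e + 1. *)
Definition elliptic_indices : {set 'I_n} := [set j : 'I_n | (2 <= j < e.+2)%N].

Record focus_coordinates (O : B) : Prop := {
  fc_nbhs : V O;
  fc_smooth : smooth_coordinates M V FHL;
  fc_elliptic : (e <= n - 2)%N;
  fc_corner : open_embedding_in (corner R n elliptic_indices) V FHL;
  fc_affF : affine_on M V F;
  fc_affL : forall i, affine_on M V (L i);
  fc_focus : V `&` focus_points M = V `&` [set x | F x = 0 /\ H x = 0];
  fc_contl : {within V, continuous Gl};
  fc_contr : {within V, continuous Gr};
  fc_affl : affine_on M left_domain Gl;
  fc_affr : affine_on M right_domain Gr;
  fc_index : 0 < k;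
  fc_left : forall x, V x -> F x <= 0 -> Gl x = Gr x;
  fc_right : forall x, V x -> 0 <= F x -> Gr x = Gl x + k * F x;
  fc_derive : forall x, V x -> ~ (F x = 0 /\ H x = 0) ->
    let gl := local_expr V FHL Gl in
    let gr := local_expr V FHL Gr in
    [/\ derivable gl (FHL x) dH, derivable gr (FHL x) dH,
        'D_dH gl (FHL x) = 'D_dH gr (FHL x) & 0 < 'D_dH gl (FHL x)];
  fc_chartl : forall x, left_domain x ->
    exists U, [/\ U x, U `<=` left_domain & affine_coordinates M U FGlL];
  fc_chartr : forall x, right_domain x ->
    exists U, [/\ U x, U `<=` right_domain & affine_coordinates M U FGrL] }.

Definition focus_box (U : set B) (d d' : R) (dL : 'I_(n - 2) -> R) : set B :=
  [set x | [/\ U x,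
               - d <= F x <= d,
               - d' <= Gl x, Gr x <= d' &
               forall i : 'I_(n - 2),
                 (if (i < e)%N then 0 else - dL i) <= L i x <= dL i]].

End FocusCoordinates.

(* The uniformity of [B] serves only to speak of uniform limits on compact
   intervals; for continuous maps these depend only on the topology. *)
Section StraightLines.
Context (R : realType) (n : nat) (B : uniformType).
Variable M : singular_affine_manifold R n B.

(* Being affine near each parameter is the same as being affine on each
   subinterval mapped into the chart. *)
Definition regular_straight_line (I : set R) (gamma : R -> B) : Prop :=
  [/\ is_interval I,
      {within I, continuous gamma},
      gamma @` I `<=` regular_points M &
      forall U y, affine_coordinates M U y ->
        forall t0, I t0 -> U (gamma t0) ->
          exists p v : 'rV[R]_n,
            \forall t \near t0, I t -> y (gamma t) = p + t *: v].

Definition singular_straight_line (I : set R) (gamma : R -> B) : Prop :=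
  [/\ is_interval I,
      {within I, continuous gamma},
      (exists u v, [/\ I u, I v & gamma u <> gamma v]),
      (exists2 u, I u & focus_points M (gamma u)) &
      forall t0, interior I t0 ->
        exists s t (gamma_ : nat -> R -> B),
          [/\ s < t0 < t, `[s, t] `<=` I,
              forall m, regular_straight_line `[s, t] (gamma_ m) &
              {uniform `[s, t], gamma_ @ \oo --> gamma}]].

Definition straight_line (I : set R) (gamma : R -> B) : Prop :=
  regular_straight_line I gamma \/ singular_straight_line I gamma.

(* Two points means two distinct points: the constant path at a focus point is
   not a straight line. *)
Definition affinely_convex (C : set B) : Prop :=
  forall x y, C x -> C y -> x <> y ->
    exists a b (gamma : R -> B),
      [/\ a < b, straight_line `[a, b] gamma, gamma a = x, gamma b = y &
          gamma @` `[a, b] `<=` C].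

End StraightLines.

(* Main.v *)
(** In the focus chart [(F, G_l, L)], which is open and injective near [O]
    because [G_l] increases with [H], the box is cut out by convex conditions,
    both for [G_l] and for [G_r = G_l + k max(0, F)].  Two points on the same
    side of the wall [F = 0] are joined by the segment in this chart.  Two points
    on opposite sides are joined by the segment that is straight for [G_l] or by
    the one that is straight for [G_r]; both meet the wall at the same [L], the
    second with the larger [G], so that either the first passes weakly on the
    left of the focus points or the second passes weakly on their right.  A
    segment that meets focus points is the uniform limit of its translates in
    the direction of [F] (same side) or of [G] (opposite sides), which are
    regular. *)

Require Import Defs.
From mathcomp Require Import all_boot all_order all_algebra.
From mathcomp Require Import all_classical all_reals all_analysis.
From mathcomp Require Import ring lra.
Import Order.TTheory GRing.Theory Num.Theory.
Import numFieldNormedType.Exports.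
Local Open Scope classical_set_scope.
Local Open Scope ring_scope.

Set Implicit Arguments.
Unset Strict Implicit.
Unset Printing Implicit Defensive.

(** * Coordinatewise convergence of row vectors *)

Section RowVectors.
Context {R : realType} {n : nat}.

Lemma cvg_row {T : Type} (Fi : set_system T) {FF : Filter Fi}
    (f : T -> 'rV[R]_n) (p : 'rV[R]_n) :
  (forall j, f t 0 j @[t --> Fi] --> p 0 j) -> f @ Fi --> p.
Proof.
move=> fp; apply/cvg_ballP => e e0.
have : \forall t \near Fi, forall j, ball (p 0 j) e (f t 0 j).
  by apply: filter_forall => j; move/cvg_ballP: (fp j); apply.
apply: filterS => t ht; split=> // i j; rewrite (ord1 i); exact: ht.
Qed.

Lemma cvg_coord {T : Type} (Fi : set_system T) {FF : Filter Fi}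
    (f : T -> 'rV[R]_n) (p : 'rV[R]_n) (j : 'I_n) :
  f @ Fi --> p -> f t 0 j @[t --> Fi] --> p 0 j.
Proof.
move=> /cvg_ballP fp; apply/cvg_ballP => e e0.
by apply: filterS (fp e e0) => t [_]; apply.
Qed.

Lemma near_row (p : 'rV[R]_n) (P : set 'rV[R]_n) : nbhs p P ->
  exists2 e : R, 0 < e & forall q : 'rV[R]_n, (forall j, `|p 0 j - q 0 j| < e) -> P q.
Proof.
move=> /nbhs_ballP [e /= e0 eP]; exists e => // q pq.
by apply: eP; split => // i j; rewrite (ord1 i); exact: pq.
Qed.

End RowVectors.

(** * The coordinates [(F, G, L)] and the corner cut out by the elliptic components *)

Section Coordinates.
Context {R : realType} {n : nat} (n_ge3 : (3 <= n)%N).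

Definition iF : 'I_n := Ordinal (leq_trans (isT : (0 < 3)%N) n_ge3).
Definition iG : 'I_n := Ordinal (leq_trans (isT : (1 < 3)%N) n_ge3).

Fact iL_subproof (i : 'I_(n - 2)) : (i.+2 < n)%N.
Proof. by rewrite -[i.+2]/(2 + i)%N -ltn_subRL. Qed.

Definition iL (i : 'I_(n - 2)) : 'I_n := Ordinal (iL_subproof i).

Lemma coordsF (a b : R) l : coords a b l 0 iF = a.
Proof. by rewrite mxE. Qed.

Lemma coordsG (a b : R) l : coords a b l 0 iG = b.
Proof. by rewrite mxE. Qed.

Lemma coordsL (a b : R) l i : coords a b l 0 (iL i) = l i.
Proof. by rewrite mxE /= valK. Qed.

Definition coordsE := (coordsF, coordsG, coordsL).

Lemma indexP (P : 'I_n -> Prop) :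
  P iF -> P iG -> (forall i, P (iL i)) -> forall j, P j.
Proof.
move=> PF PG PL [[|[|j]] hj].
- by rewrite (_ : Ordinal hj = iF) //; apply: val_inj.
- by rewrite (_ : Ordinal hj = iG) //; apply: val_inj.
- have hj2 : (j < n - 2)%N by rewrite ltn_subRL.
  by rewrite (_ : Ordinal hj = iL (Ordinal hj2)) //; apply: val_inj.
Qed.

Lemma coords_eq (p : 'rV[R]_n) (a b : R) l :
  p 0 iF = a -> p 0 iG = b -> (forall i, p 0 (iL i) = l i) -> p = coords a b l.
Proof.
move=> pa pb pl; apply/rowP; apply: indexP; rewrite ?coordsE //.
by move=> i; rewrite coordsE.
Qed.

Lemma coords_shift (a b h : R) l :
  h *: dH R n + coords a b l = coords a (h + b) l.
Proof.
apply: coords_eq => [||i]; rewrite mxE [X in X + _]mxE !coordsE; ring.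
Qed.

Lemma cvg_coords {T : Type} (Fi : set_system T) {FF : Filter Fi}
    (a b : T -> R) (l : T -> 'I_(n - 2) -> R) a0 b0 l0 :
  a @ Fi --> a0 -> b @ Fi --> b0 -> (forall i, l t i @[t --> Fi] --> l0 i) ->
  coords (a t) (b t) (l t) @[t --> Fi] --> coords a0 b0 l0.
Proof.
move=> ha hb hl; apply: cvg_row; apply: indexP => [||i].
- by rewrite coordsE; under eq_fun do rewrite coordsE.
- by rewrite coordsE; under eq_fun do rewrite coordsE.
- by rewrite coordsE; under eq_fun do rewrite coordsE; exact: hl.
Qed.

Lemma corner_elliptic (B : topologicalType) (c : multivalued_coords R n B)
    (p : 'rV[R]_n) :
  corner R n (elliptic_indices c) p <->
  (forall i : 'I_(n - 2), (i < mc_e c)%N -> 0 <= p 0 (iL i)).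
Proof.
split=> [hp i ie|hp]; first by apply: hp; rewrite inE /= !ltnS.
suff: forall j, j \in elliptic_indices c -> 0 <= p 0 j by [].
refine (@indexP (fun j : 'I_n => j \in elliptic_indices c -> 0 <= p 0 j) _ _ _).
- by rewrite inE.
- by rewrite inE.
- by move=> i; rewrite inE /= !ltnS; exact: hp.
Qed.

End Coordinates.

(** * The smooth chart [FHL] and the openness of the focus chart [FGlL] *)

Section FocusChart.
Context {R : realType} {n : nat} (n_ge3 : (3 <= n)%N) {B : topologicalType}.
Context {M : singular_affine_manifold R n B} {c : multivalued_coords R n B}.
Context {O : B} (cf : focus_coordinates M c O).

Notation V := (mc_V c).
Notation F := (mc_F c).
Notation H := (mc_H c).
Notation L := (mc_L c).
Notation Gl := (mc_Gl c).
Notation corn := (corner R n (elliptic_indices c)).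
Notation iF := (iF n_ge3).
Notation iG := (iG n_ge3).
Notation gl := (local_expr V (FHL c) Gl).

Lemma V_open : open V.
Proof. by case: (fc_corner cf). Qed.

Lemma FHL_corner x : V x -> corn (FHL c x).
Proof.
case: (fc_corner cf) => oV _ _ /(_ V oV (@subset_refl _ _)) [A _ e] Vx.
by have [] : (A `&` corn) (FHL c x) by rewrite -e; exists x.
Qed.

Lemma FHL_inj x y : V x -> V y -> FHL c x = FHL c y -> x = y.
Proof. by case: (fc_corner cf) => _ i _ _ Vx Vy; apply: i; rewrite inE. Qed.

Lemma cvg_on_V (T : topologicalType) (f : B -> T) x :
  {within V, continuous f} -> V x -> f @ x --> f x.
Proof.
by rewrite (continuous_open_subspace _ V_open) => h Vx; apply: h; rewrite inE.
Qed.

Lemma FHL_cvg x : V x -> FHL c @ x --> FHL c x.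
Proof. by apply: cvg_on_V; case: (fc_corner cf). Qed.

Lemma FHL_image x (N : set B) : V x -> nbhs x N ->
  \forall q \near FHL c x, corn q -> exists z, [/\ V z, N z & FHL c z = q].
Proof.
move=> Vx; rewrite nbhsE => -[W [oW Wx] WN].
case: (fc_corner cf) => _ _ _ /(_ (V `&` W) (openI V_open oW)).
case=> [z []//|A oA e].
have [Ax _] : (A `&` corn) (FHL c x) by rewrite -e; exists x.
apply: filterS (open_nbhs_nbhs (conj oA Ax)) => q Aq cq.
have : (A `&` corn) q by [].
by rewrite -e => -[z [Vz Wz] zq]; exists z; split=> //; exact: WN.
Qed.

Lemma local_exprE (f : B -> R) z :
  V z -> local_expr V (FHL c) f (FHL c z) = f z.
Proof.
move=> Vz; rewrite /local_expr; case: xgetP => [r _ [y [Vy yz <-]]|/(_ (f z))].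
  by rewrite (FHL_inj Vy Vz yz).
by case; exists z.
Qed.

(** The limit is taken within the corner because [gl] has the default value 0 off the image of [V],
    which is open only relative to the corner. *)
Lemma gl_cvg z : V z -> gl @ within corn (nbhs (FHL c z)) --> Gl z.
Proof.
move=> Vz W nW; have := cvg_on_V (fc_contl cf) Vz nW.
move=> /(FHL_image Vz); apply: filterS => q hq cq.
by have [y [Vy Wy <-]] := hq cq; rewrite /= local_exprE.
Qed.

(** The corner constrains only [L] coordinates, so varying [H] alone never leaves it, and the limit
    is two-sided even at boundary points. *)
Lemma vertical_cvg z a l h : V z -> FHL c z = coords a h l ->
  gl (coords a t l) @[t --> h] --> Gl z.
Proof.
move=> Vz ez; have cz := FHL_corner Vz.
move=> W /(gl_cvg Vz) hQ.
have hc : coords a t l @[t --> h] --> FHL c z.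
  by rewrite ez; apply: cvg_coords => // [|i]; [exact: cvg_cst|exact: cvg_cst].
have := hc _ hQ; rewrite !nbhs_simpl /=; apply: filterS => t hW.
suff: corn (coords a t l) by exact: hW.
move: cz; rewrite ez !(corner_elliptic n_ge3) => cz i /cz.
by rewrite !coordsE.
Qed.

Lemma vertical_derive z a l h : V z -> FHL c z = coords a h l ->
  ~ (F z = 0 /\ H z = 0) ->
  is_derive h 1 (fun t => gl (coords a t l)) ('D_(dH R n) gl (FHL c z)) /\
  0 < 'D_(dH R n) gl (FHL c z).
Proof.
move=> Vz ez nz; have [dgl _ _ pos] := fc_derive cf Vz nz; split=> //.
have e : (fun t : R => t^-1 *: (((fun t => gl (coords a t l)) \o shift h)
     (t *: (1 : R)) - gl (coords a h l)))
   = (fun t => t^-1 *: ((gl \o shift (FHL c z)) (t *: dH R n) - gl (FHL c z))).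
  apply/funext => t /=; congr (_ *: (gl _ - gl _)) => //.
  by rewrite ez (coords_shift n_ge3) -[t *: 1]/(t * 1) mulr1.
apply: DeriveDef; first by rewrite /derivable e.
by rewrite /derive e.
Qed.

Lemma FHLE z : (FHL c z 0 iF = F z) * (FHL c z 0 iG = H z) *
  (forall i, FHL c z 0 (iL i) = L i z).
Proof. by split; [split|move=> i]; rewrite coordsE. Qed.

Lemma FGlLE z : (FGlL c z 0 iF = F z) * (FGlL c z 0 iG = Gl z) *
  (forall i, FGlL c z 0 (iL i) = L i z).
Proof. by split; [split|move=> i]; rewrite coordsE. Qed.

Lemma corner_coords a h l : corn (coords a h l) <->
  (forall i : 'I_(n - 2), (i < mc_e c)%N -> 0 <= l i).
Proof.
rewrite (corner_elliptic n_ge3).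
by split=> hl i /hl; rewrite coordsE.
Qed.

Lemma FGlL_corner x : V x -> corn (FGlL c x).
Proof. by move=> /FHL_corner; rewrite !corner_coords. Qed.

Section VerticalSegment.
Variables (a : R) (l : 'I_(n - 2) -> R).

(** Mean value theorem on a segment with no focus point strictly inside: positivity of the
    derivative is used in the open interval, only continuity at the ends. *)
Let vertical_lt_aux h1 h2 :
  (forall h, h1 <= h <= h2 -> exists2 z, V z & FHL c z = coords a h l) ->
  h1 < h2 -> (a = 0 -> ~ (h1 < 0 < h2)) ->
  gl (coords a h1 l) < gl (coords a h2 l).
Proof.
move=> hV h12 h0.
have der h : h \in `]h1, h2[ ->
    is_derive h 1 (fun t => gl (coords a t l)) ('D_(dH R n) gl (coords a h l)) /\
    0 < 'D_(dH R n) gl (coords a h l).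
  rewrite in_itv /= => /[dup] hh /andP[/ltW h1h /ltW hh2].
  have [z Vz ez] : exists2 z, V z & FHL c z = coords a h l.
    by apply: hV; rewrite h1h hh2.
  rewrite -ez; apply: vertical_derive => //.
  rewrite -(FHLE z).1.1 -(FHLE z).1.2 ez !coordsE => -[a0 hz].
  by apply: h0 => //; rewrite -hz.
have [|t /der[_ t0] e] := MVT h12 (fun t ht => (der t ht).1).
  apply: continuous_in_subspaceT => t; rewrite inE /= in_itv /= => /hV [z Vz ez].
  by rewrite /continuous_at -ez local_exprE //; exact: vertical_cvg.
by rewrite -subr_gt0 e mulr_gt0 // subr_gt0.
Qed.

(** Nothing is known of the derivative at a focus point, but a vertical segment can contain one only
    at height 0; cutting there leaves two pieces without focus points inside. *)
Lemma vertical_lt h1 h2 :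
  (forall h, h1 <= h <= h2 -> exists2 z, V z & FHL c z = coords a h l) ->
  h1 < h2 -> gl (coords a h1 l) < gl (coords a h2 l).
Proof.
move=> hV h12.
have [/andP[h10 h02]|h0] := boolP (h1 < 0 < h2); last first.
  by apply: vertical_lt_aux => // _; exact/negP.
apply: (@lt_trans _ _ (gl (coords a 0 l))); apply: vertical_lt_aux => //.
- by move=> h /andP[h1h hh0]; apply: hV; rewrite h1h (le_trans hh0 (ltW h02)).
- by move=> _; rewrite ltxx andbF.
- by move=> h /andP[h1h hh0]; apply: hV; rewrite hh0 (le_trans (ltW h10)).
- by move=> _; rewrite ltxx.
Qed.

End VerticalSegment.

(** Here [z] lies on the vertical line of [x] at height [h]. With this height frozen and [F], [L]
    read from [p], continuity controls [Gl] at the ends of nearby vertical segments. *)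
Lemma cvg_lift x z h (W : set R) : V x -> V z ->
  FHL c z = coords (F x) h (L ^~ x) -> nbhs (Gl z) W ->
  \forall p \near FGlL c x, corn p ->
    W (gl (coords (p 0 iF) h (fun i => p 0 (iL i)))).
Proof.
move=> Vx Vz ez /(gl_cvg Vz) hW.
have hc : coords ((p : 'rV[R]_n) 0 iF) h (fun i => p 0 (iL i))
    @[p --> FGlL c x] --> FHL c z.
  rewrite ez; apply: (@cvg_coords R n n_ge3 _ (nbhs (FGlL c x))).
  - by rewrite -(FGlLE x).1.1; exact: cvg_coord.
  - exact: cvg_cst.
  - by move=> i; rewrite -(FGlLE x).2; exact: cvg_coord.
have := hc _ hW; rewrite !nbhs_simpl /=; apply: filterS => p hp cp.
suff: corn (coords (p 0 iF) h (fun i => p 0 (iL i))) by exact: hp.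
by apply/corner_coords; exact/(corner_elliptic n_ge3).
Qed.

(* [FGlL] is open onto the corner: on a vertical segment around [x] the values
   of [Gl] at the ends stay on both sides of the prescribed value, and the
   intermediate value theorem applies. *)
Lemma FGlL_open x (N : set B) : V x -> nbhs x N ->
  \forall p \near FGlL c x, corn p -> exists2 z, V z /\ N z & FGlL c z = p.
Proof.
move=> Vx nN.
have [e e0 he] := near_row (FHL_image Vx nN).
have cx := (corner_coords _ _ _).1 (FHL_corner Vx).
have hcol (h : R) : H x - e / 2 <= h <= H x + e / 2 ->
    exists2 z, V z & FHL c z = coords (F x) h (L ^~ x).
  move=> hh; have [||z [Vz _ ez]] := he (coords (F x) h (L ^~ x)).
  - elim/(@indexP _ n_ge3) => [||i]; rewrite ?FHLE coordsE ?subrr ?normr0 //.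
    by rewrite ltr_norml; case/andP: hh => ? ?; apply/andP; split; lra.
  - exact/corner_coords.
  - by exists z.
have [zm Vm em] : exists2 z, V z & FHL c z = coords (F x) (H x - e / 2) (L ^~ x).
  by apply: hcol; lra.
have [zp Vp ep] : exists2 z, V z & FHL c z = coords (F x) (H x + e / 2) (L ^~ x).
  by apply: hcol; lra.
have lm : Gl zm < Gl x.
  rewrite -(local_exprE Gl Vm) -(local_exprE Gl Vx) em; apply: vertical_lt; last lra.
  by move=> h /andP[? ?]; apply: hcol; apply/andP; split; lra.
have lp : Gl x < Gl zp.
  rewrite -(local_exprE Gl Vp) -(local_exprE Gl Vx) ep; apply: vertical_lt; last lra.
  by move=> h /andP[? ?]; apply: hcol; apply/andP; split; lra.
have cG : (p : 'rV[R]_n) 0 iG @[p --> FGlL c x] --> Gl x.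
  by rewrite -(FGlLE x).1.2; exact: (@cvg_coord R n _ (nbhs (FGlL c x)) _ id).
have nb j : \forall p \near FGlL c x, `|FGlL c x 0 j - (p : 'rV[R]_n) 0 j| < e.
  have := @cvg_coord R n _ (nbhs (FGlL c x)) _ id (FGlL c x) j cvg_id.
  by move=> /(_ _)/cvgr_dist_lt; exact.
near=> p => cp.
have pm : gl (coords (p 0 iF) (H x - e / 2) (fun i => p 0 (iL i))) < p 0 iG.
  (* As [p] tends to [FGlL c x] the two sides tend to [Gl zm] and [Gl x], which the midpoint
     separates; the upper end is treated alike. *)
  apply: (@lt_trans _ _ ((Gl zm + Gl x) / 2)).
    move: cp; near: p; apply: (@cvg_lift _ zm _ [set s | s < (Gl zm + Gl x) / 2]) => //.
    by apply: lt_nbhsl; lra.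
  by near: p; apply: (cvgr_gt _ cG); lra.
have pp : p 0 iG < gl (coords (p 0 iF) (H x + e / 2) (fun i => p 0 (iL i))).
  apply: (@lt_trans _ _ ((Gl x + Gl zp) / 2)).
    by near: p; apply: (cvgr_lt _ cG); lra.
  move: cp; near: p; apply: (@cvg_lift _ zp _ [set s | (Gl x + Gl zp) / 2 < s]) => //.
  by apply: lt_nbhsr; lra.
have pe j : `|FGlL c x 0 j - p 0 j| < e.
  by move: j; near: p; exact: filter_forall.
have colp (h : R) : H x - e / 2 <= h <= H x + e / 2 -> exists z, [/\ V z, N z &
    FHL c z = coords (p 0 iF) h (fun i => p 0 (iL i))].
  move=> hh; apply: he.
    elim/(@indexP _ n_ge3) => [||i]; rewrite FHLE coordsE.
    - by rewrite -(FGlLE x).1.1.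
    - by rewrite ltr_norml; case/andP: hh => ? ?; apply/andP; split; lra.
    - by rewrite -(FGlLE x).2.
  by apply/corner_coords; exact/(corner_elliptic n_ge3).
have [|||h] := @IVT R (fun h => gl (coords (p 0 iF) h (fun i => p 0 (iL i))))
    (H x - e / 2) (H x + e / 2) (p 0 iG).
- lra.
- apply: continuous_in_subspaceT => t; rewrite inE /= in_itv /= => /colp [z [Vz _ ez]].
  by rewrite /continuous_at -ez local_exprE //; exact: vertical_cvg.
- by rewrite ge_min le_max (ltW pm) (ltW pp) orbT.
rewrite in_itv /= => /colp [z [Vz Nz ez]] e1; exists z => //.
apply/esym/(coords_eq (n_ge3 := n_ge3)).
- by rewrite -(FHLE z).1.1 ez coordsE.
- by rewrite -e1 -ez local_exprE.
- by move=> i; rewrite -(FHLE z).2 ez coordsE.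
Unshelve. all: by end_near.
Qed.

(** * Injectivity of the focus chart near [O] and continuity of its inverse *)

Section FocusNeighborhood.
Variable r : R.

Definition cube : set 'rV[R]_n := [set p | forall j, `|p 0 j| < r].

(** A cube in the chart [FHL], so that the vertical segment between two of its points with equal [F]
    and [L] stays in the cube and can be lifted by [cube_lift]. *)
Definition focus_nbhd : set B := [set x | V x /\ cube (FHL c x)].

Hypothesis cube_lift :
  forall q, cube q -> corn q -> exists2 z, V z & FHL c z = q.

Lemma Gl_lt x y : focus_nbhd x -> focus_nbhd y ->
  F x = F y -> (forall i, L i x = L i y) -> H x < H y -> Gl x < Gl y.
Proof.
move=> [Vx cx] [Vy cy] Fxy Lxy Hxy.
rewrite -(local_exprE Gl Vx) -(local_exprE Gl Vy).
have ey : FHL c y = coords (F x) (H y) (L ^~ x).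
  by apply: (coords_eq (n_ge3 := n_ge3)) => [||i]; rewrite FHLE.
rewrite ey; apply: vertical_lt => // h hh; apply: cube_lift.
  elim/(@indexP _ n_ge3) => [||i]; rewrite coordsE.
  - by have := cx iF; rewrite FHLE.
  - have := cx iG; have := cy iG; rewrite !FHLE !ltr_norml.
    by move: hh => /andP[? ?] /andP[? ?] /andP[? ?]; apply/andP; split; lra.
  - by have := cx (iL i); rewrite FHLE.
by apply/corner_coords; apply/(corner_coords (F x) (H x)); exact: FHL_corner.
Qed.

Lemma FGlL_inj x y : focus_nbhd x -> focus_nbhd y ->
  FGlL c x = FGlL c y -> x = y.
Proof.
move=> bx by_ exy.
have Fxy : F x = F y by rewrite -!(FGlLE _).1.1 exy.
have Gxy : Gl x = Gl y by rewrite -!(FGlLE _).1.2 exy.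
have Lxy i : L i x = L i y by rewrite -!(FGlLE _).2 exy.
have [Hxy|Hxy|Hxy] := ltgtP (H x) (H y).
- by have := Gl_lt bx by_ Fxy Lxy Hxy; rewrite Gxy ltxx.
- have := Gl_lt by_ bx (esym Fxy) (fun i => esym (Lxy i)) Hxy.
  by rewrite Gxy ltxx.
- apply: FHL_inj; [exact: bx.1|exact: by_.1|].
  by apply/rowP; elim/(@indexP _ n_ge3) => [||i]; rewrite !FHLE.
Qed.

Definition FGlL_inv (p : 'rV[R]_n) : B :=
  xget O [set x | focus_nbhd x /\ FGlL c x = p].

Lemma FGlL_invK x : focus_nbhd x -> FGlL_inv (FGlL c x) = x.
Proof.
move=> bx; rewrite /FGlL_inv; case: xgetP => [y _ [by_ e]|/(_ x)[]//].
exact: FGlL_inj.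
Qed.

Lemma focus_nbhd_nbhs x : focus_nbhd x -> nbhs x focus_nbhd.
Proof.
move=> [Vx cx].
have nc : \forall y \near x, forall j, `|FHL c y 0 j| < r.
  apply: filter_forall => j; have hj := cvg_coord (j := j) (FHL_cvg Vx).
  exact: (cvgr_lt _ (cvg_norm (hj _)) _ (cx j)).
by apply: filterI nc; exact: (open_nbhs_nbhs (conj V_open Vx)).
Qed.

(** By openness of [FGlL], nearby points of the corner have a preimage in any given neighbourhood of
    [x]; injectivity identifies it with the value of [FGlL_inv]. *)
Lemma FGlL_inv_cvg x : focus_nbhd x ->
  FGlL_inv @ within corn (nbhs (FGlL c x)) --> x.
Proof.
move=> bx W nW.
have nWb : nbhs x (W `&` focus_nbhd) by apply: filterI nW (focus_nbhd_nbhs bx).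
have := FGlL_open bx.1 nWb.
apply: filterS => p hp cp; have [z [_ [Wz bz]] <-] := hp cp.
by rewrite /= FGlL_invK.
Qed.

End FocusNeighborhood.

End FocusChart.

(** * Regular lines from one chart per point, and uniform convergence on compact sets *)

Lemma affine_coordinates_span {R : realType} {n : nat} {B : topologicalType}
    (M : singular_affine_manifold R n B) (U W : set B) (y w : B -> 'rV[R]_n)
    (x : B) :
  affine_coordinates M U y -> affine_coordinates M W w -> U x -> W x ->
  exists (p : 'rV[R]_n) (A : 'M[R]_n), \forall z \near x, w z = p + y z *m A.
Proof.
move=> [_ _ span] [[[oW _ _ _] _] affw _] Ux Wx.
have hs i := span x W _ Ux oW Wx (affw i).
have [a0 ha0] := choice hs.
have [a ha] := choice ha0.
exists (\row_i a0 i), (\matrix_(j, i) a i j).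
have : \forall z \near x, forall i, w z 0 i = a0 i + \sum_(j < n) a i j * y z 0 j.
  exact: filter_forall.
apply: filterS => z hz; apply/rowP => i.
by rewrite hz !mxE; congr (_ + _); apply: eq_bigr => j _; rewrite mxE mulrC.
Qed.

(** Transition maps between affine charts are locally affine, so being affine in one chart around
    each point suffices. *)
Lemma regular_straight_lineP {R : realType} {n : nat} {B : uniformType}
    (M : singular_affine_manifold R n B) (I : set R) (gamma : R -> B) :
  is_interval I -> {within I, continuous gamma} ->
  (forall t, I t -> exists U y p v, [/\ affine_coordinates M U y, U (gamma t) &
     forall s, I s -> y (gamma s) = p + s *: v]) ->
  regular_straight_line M I gamma.
Proof.
move=> iI cI hI; split=> // [_ [t It <-]|W w cw t It Wt].
  by have [U [y [_ [_ [cy Ut _]]]]] := hI t It; exists U, y.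
have [U [y [p [v [cy Ut yI]]]]] := hI t It.
have [p' [A hA]] := affine_coordinates_span cy cw Ut Wt.
exists (p' + p *m A), (v *m A).
have hs : \forall s \near t, I s -> w (gamma s) = p' + y (gamma s) *m A.
  exact: ((subspace_continuousP I gamma).1 cI t It _ hA).
apply: filterS hs => s + Is => /(_ Is) ->.
by rewrite yI // mulmxDl -scalemxAl addrA.
Qed.

(** Compactness, as the near covering property, turns joint convergence in [(x', m)] at each point
    into a single rank [m]; [g x'] and [g_ m x'] are both compared with [g x] by half of the
    entourage [E]. *)
Lemma uniform_cvg_compact {X : topologicalType} {B : uniformType} (K : set X)
    (g_ : nat -> X -> B) (g : X -> B) :
  compact K -> {within K, continuous g} ->
  (forall x, K x -> forall W, nbhs (g x) W ->
     \forall x' \near x & m \near \oo, K x' -> W (g_ m x')) ->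
  {uniform K, g_ @ \oo --> g}.
Proof.
move=> /compact_near_coveringP/near_covering_withinP cK cg cg_ P.
move=> /uniform_nbhs [E [entE EP]].
suff : \forall m \near \oo, K `<=` fun x => E (g x, g_ m x).
  by apply: filterS => m hm; apply: EP; exact: hm.
apply: cK => x Kx.
have nE : nbhs (g x) (xsection (split_ent E) (g x)) by exact: nbhs_entourage.
have nE' : nbhs (g x) (xsection ((split_ent E)^-1)%relation (g x)).
  exact/nbhs_entourage/entourage_inv.
have cgx : \forall x' \near x & m \near \oo, K x' ->
    xsection ((split_ent E)^-1)%relation (g x) (g x').
  have := (subspace_continuousP K g).1 cg x Kx _ nE'.
  move=> hx; exists (fun x' => K x' ->
    xsection ((split_ent E)^-1)%relation (g x) (g x'), setT) => /=.
    by split => //; exact: filterT.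
  by case=> x' m [/= + _].
apply: filterS2 cgx (cg_ x Kx _ nE) => -[x' m] /= h1 h2 Kx'.
apply: (entourage_split (g x)) => //.
  by have /xsectionP := h1 Kx'.
by have /xsectionP := h2 Kx'.
Qed.

Definition affine_on_unit {R : realType} (g : R -> R) : Prop :=
  exists a b, forall t, t \in `[0, 1] -> g t = a + t * b.

(** * Curves given in the focus chart and their translates *)

Section Curves.
Context {R : realType} {n : nat} (n_ge3 : (3 <= n)%N) {B : uniformType}.
Context {M : singular_affine_manifold R n B} {c : multivalued_coords R n B}.
Context {O : B} (cf : focus_coordinates M c O).
Variable r : R.
Hypothesis cube_lift : forall q, cube r q ->
  corner R n (elliptic_indices c) q -> exists2 z, mc_V c z & FHL c z = q.

Notation V := (mc_V c).
Notation F := (mc_F c).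
Notation H := (mc_H c).
Notation L := (mc_L c).
Notation Gl := (mc_Gl c).
Notation Gr := (mc_Gr c).
Notation k := (mc_k c).
Notation corn := (corner R n (elliptic_indices c)).
Notation N := (@focus_nbhd R n B c r).
Notation inv := (@FGlL_inv R n B c O r).
Notation K := [set` `[(0 : R), 1]].

Lemma H_lt x y : N x -> N y -> F x = F y -> (forall i, L i x = L i y) ->
  Gl x < Gl y -> H x < H y.
Proof.
move=> bx by_ Fxy Lxy Gxy.
have [//|Hyx|Hxy] := ltgtP (H x) (H y).
  have := Gl_lt n_ge3 cf cube_lift by_ bx (esym Fxy) (fun i => esym (Lxy i)) Hyx.
  by rewrite ltNge (ltW Gxy).
suff e : x = y by move: Gxy; rewrite e ltxx.
apply: (FHL_inj cf); [exact: bx.1|exact: by_.1|].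
by apply/rowP; elim/(@indexP _ n_ge3) => [||i]; rewrite !FHLE.
Qed.

Lemma Gr_Gl x : V x -> Gr x = Gl x + k * Num.max 0 (F x).
Proof.
move=> Vx; have [F0|F0] := leP (F x) 0.
  by rewrite mulr0 addr0 (fc_left cf).
by rewrite (fc_right cf Vx (ltW F0)).
Qed.

Definition liftable (p : 'rV[R]_n) := exists2 x, N x & FGlL c x = p.

Lemma liftableP p : liftable p -> N (inv p) /\ FGlL c (inv p) = p.
Proof. by case=> x Nx <-; rewrite (FGlL_invK n_ge3 cf cube_lift). Qed.

(** The inverse chart is continuous only relative to the corner; liftable vectors lie in the corner,
    so convergence carries over along the parameters in [D]. *)
Lemma inv_cvg {T : Type} (Fi : set_system T) {FF : Filter Fi}
    (u : T -> 'rV[R]_n) (D : set T) p : liftable p -> u @ Fi --> p ->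
  (forall t, D t -> liftable (u t)) ->
  forall W, nbhs (inv p) W -> \forall t \near Fi, D t -> W (inv (u t)).
Proof.
move=> lp up lu W nW; have [Np ep] := liftableP lp.
have hW : \forall q \near p, corn q -> W (inv q).
  have := FGlL_inv_cvg n_ge3 cf cube_lift Np nW.
  by rewrite ep.
have hu : \forall t \near Fi, corn (u t) -> W (inv (u t)) by exact: up _ hW.
apply: filterS hu => t hW' Dt; apply: hW'.
have [[Nu _] <-] := liftableP (lu _ Dt).
by apply: (FGlL_corner n_ge3 cf).
Qed.

Section Curve.
Variables (f g : R -> R) (l : 'I_(n - 2) -> R -> R).
Let q t := coords (f t) (g t) (l ^~ t).
Let gamma t := inv (q t).
Hypothesis (fc : continuous f) (gc : continuous g) (lc : forall i, continuous (l i)).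
Hypothesis ql : forall t, K t -> liftable (q t).

Lemma cvg_q t : q @ t --> q t.
Proof. by apply: (cvg_coords n_ge3) => [||i]; [exact: fc|exact: gc|exact: lc]. Qed.

Lemma curve_continuous : {within K, continuous gamma}.
Proof.
apply/subspace_continuousP => t Kt W nW.
have h : \forall s \near t, K s -> W (gamma s).
  exact: (@inv_cvg _ (nbhs t) _ q K (q t) (ql Kt) (@cvg_q t) ql W nW).
exact: h.
Qed.

Lemma curveE t : K t -> [/\ N (gamma t), F (gamma t) = f t, Gl (gamma t) = g t,
  forall i, L i (gamma t) = l i t & Gr (gamma t) = g t + k * Num.max 0 (f t)].
Proof.
move=> Kt; have [Nt et] := liftableP (ql Kt).
have eF : F (gamma t) = f t by rewrite -(FGlLE n_ge3 _).1.1 et coordsE.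
have eG : Gl (gamma t) = g t by rewrite -(FGlLE n_ge3 _).1.2 et coordsE.
split=> // [i|]; first by rewrite -(FGlLE n_ge3 _).2 et coordsE.
by rewrite Gr_Gl ?eF ?eG //; case: Nt.
Qed.

Hypothesis (fa : affine_on_unit f) (la : forall i, affine_on_unit (l i)).

(** At each parameter [FGlL] or [FGrL] is an affine chart in which the curve has an affine formula
    on all of [[0, 1]]; the second function is [Gr] along the curve. *)
Lemma curve_regular :
  (forall t, K t ->
    (left_domain c (gamma t) /\ affine_on_unit g) \/
    (right_domain c (gamma t) /\ affine_on_unit (fun t => g t + k * Num.max 0 (f t)))) ->
  regular_straight_line M K gamma.
Proof.
move=> hK; have [f0 [f1 fE]] := fa.
have [l0 /choice [l1 lE]] := choice la.
apply: regular_straight_lineP; [exact: interval_is_interval|exact: curve_continuous|].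
move=> t Kt; have [[dt [g0 [g1 gE]]]|[dt [g0 [g1 gE]]]] := hK t Kt.
- have [U [Ut _ cU]] := fc_chartl cf dt.
  exists U, (FGlL c), (coords f0 g0 l0), (coords f1 g1 l1); split=> // s Ks.
  have [_ eF eG eL _] := curveE Ks.
  apply/rowP; elim/(@indexP _ n_ge3) => [||i];
    by rewrite [RHS]mxE [X in _ + X]mxE !coordsE ?eF ?eG ?eL ?gE ?lE ?fE.
- have [U [Ut _ cU]] := fc_chartr cf dt.
  exists U, (FGrL c), (coords f0 g0 l0), (coords f1 g1 l1); split=> // s Ks.
  have [_ eF _ eL eG] := curveE Ks.
  apply/rowP; elim/(@indexP _ n_ge3) => [||i];
    by rewrite [RHS]mxE [X in _ + X]mxE !coordsE ?eF ?eG ?eL ?gE ?lE ?fE.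
Qed.

End Curve.

Section Shift.
Variables (f g : R -> R) (l : 'I_(n - 2) -> R -> R) (a b : R).
Hypothesis (fc : continuous f) (gc : continuous g) (lc : forall i, continuous (l i)).
Let q s t := coords (f t + s * a) (g t + s * b) (l ^~ t).
Let gamma t := inv (coords (f t) (g t) (l ^~ t)).
Let gamma_ m t := inv (q (harmonic m) t).
Hypothesis ql : forall t, K t -> liftable (coords (f t) (g t) (l ^~ t)).
Hypothesis ql_ : forall m t, K t -> liftable (q (harmonic m) t).

(** Since [harmonic m] tends to 0, the translated coordinates converge jointly in the parameter and
    [m]; continuity of the inverse chart and compactness of [[0, 1]] do the rest. *)
Lemma shift_cvg : {uniform K, gamma_ @ \oo --> gamma}.
Proof.
apply: uniform_cvg_compact; first exact: segment_compact.
  exact: curve_continuous.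
move=> t Kt W nW.
have h : \forall p \near (nbhs t, \oo), K p.1 -> W (gamma_ p.2 p.1).
  apply: (@inv_cvg _ (filter_prod (nbhs t) \oo) _
    (fun p : R * nat => q (harmonic p.2) p.1) [set p | K p.1] _ (ql Kt)) => //.
    have sh (e : R) : harmonic p.2 * e @[p --> (nbhs t, \oo)] --> (0 : R).
      rewrite -[X in _ --> X](mul0r e); apply: cvgM; last exact: cvg_cst.
      exact: (cvg_comp _ _ cvg_snd (@cvg_harmonic R)).
    have ct (u : R -> R) : continuous u -> u p.1 @[p --> (nbhs t, \oo)] --> u t.
      by move=> cu; apply: (cvg_comp fst u cvg_fst); exact: cu.
    apply: (@cvg_coords R n n_ge3 _ (filter_prod (nbhs t) \oo)) => [||i].
    - by rewrite -[X in _ --> X]addr0; apply: cvgD; [exact: ct|exact: sh].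
    - by rewrite -[X in _ --> X]addr0; apply: cvgD; [exact: ct|exact: sh].
    - exact: ct.
  by move=> [s m] Ks; exact: ql_.
exact: h.
Qed.

Lemma shift_straight_line :
  gamma 0 <> gamma 1 ->
  (forall m, regular_straight_line M K (gamma_ m)) ->
  ((forall t, K t -> ~ (F (gamma t) = 0 /\ H (gamma t) = 0)) ->
    regular_straight_line M K gamma) ->
  straight_line M K gamma.
Proof.
move=> g01 reg_ reg.
have [no|/existsNP [t /not_implyP [Kt /contrapT foc]]] :=
  pselect (forall t, K t -> ~ (F (gamma t) = 0 /\ H (gamma t) = 0)).
  by left; exact: reg.
right; split.
- exact: interval_is_interval.
- exact: curve_continuous.
- by exists 0, 1; split => //; rewrite /= in_itv /= lexx ler01.
- exists t => //; have [[Vt _] _] := liftableP (ql Kt).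
  suff [] : (V `&` focus_points M) (gamma t) by [].
  by rewrite (fc_focus cf).
move=> t0; rewrite interior_itv_bnd /= in_itv /= => t01.
(* The whole interval [[0, 1]] serves every interior parameter. *)
by exists 0, 1, gamma_; split => //; exact: shift_cvg.
Qed.

End Shift.
End Curves.

(** * Linear interpolation and the positive part *)

Definition lerp {R : realType} (u v t : R) : R := u + t * (v - u).

Section Lerp.
Context {R : realType}.

Lemma lerp_continuous (u v : R) : continuous (lerp u v).
Proof.
move=> t; apply: cvgD; first exact: cvg_cst.
by apply: cvgM; [exact: cvg_id|exact: cvg_cst].
Qed.

Lemma lerp_affine (u v : R) : affine_on_unit (lerp u v).
Proof. by exists u, (v - u). Qed.

Lemma lerp0 (u v : R) : lerp u v 0 = u.
Proof. by rewrite /lerp mul0r addr0. Qed.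

Lemma lerp1 (u v : R) : lerp u v 1 = v.
Proof. by rewrite /lerp mul1r addrC subrK. Qed.

Lemma lerpE (u v t : R) : lerp u v t = (1 - t) * u + t * v.
Proof. rewrite /lerp; ring. Qed.

Lemma lerp_ge (m u v t : R) : 0 <= t <= 1 -> m <= u -> m <= v -> m <= lerp u v t.
Proof. by move=> /andP[t0 t1] mu mv; rewrite lerpE; nra. Qed.

Lemma lerp_le (m u v t : R) : 0 <= t <= 1 -> u <= m -> v <= m -> lerp u v t <= m.
Proof. by move=> /andP[t0 t1] mu mv; rewrite lerpE; nra. Qed.

(** This convexity of the positive part puts the candidate straight for [Gr] weakly above the one
    straight for [Gl]. *)
Lemma max0_lerp (u v t : R) : 0 <= t <= 1 ->
  Num.max 0 (lerp u v t) <= lerp (Num.max 0 u) (Num.max 0 v) t.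
Proof.
move=> /andP[t0 t1]; rewrite ge_max !lerpE.
have u1 : u <= Num.max 0 u by rewrite le_max lexx orbT.
have v1 : v <= Num.max 0 v by rewrite le_max lexx orbT.
have u0 : 0 <= Num.max 0 u by rewrite le_max lexx.
have v0 : 0 <= Num.max 0 v by rewrite le_max lexx.
by apply/andP; split; nra.
Qed.

End Lerp.

(** * Joining two points of a focus box *)

Section FocusBox.
Context {R : realType} {n : nat} (n_ge3 : (3 <= n)%N) {B : uniformType}.
Context {M : singular_affine_manifold R n B} {c : multivalued_coords R n B}.
Context {O : B} (cf : focus_coordinates M c O).
Variable r : R.
Hypothesis cube_lift : forall q, cube r q ->
  corner R n (elliptic_indices c) q -> exists2 z, mc_V c z & FHL c z = q.

Notation V := (mc_V c).
Notation F := (mc_F c).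
Notation H := (mc_H c).
Notation L := (mc_L c).
Notation Gl := (mc_Gl c).
Notation Gr := (mc_Gr c).
Notation k := (mc_k c).
Notation corn := (corner R n (elliptic_indices c)).
Notation N := (@focus_nbhd R n B c r).
Notation inv := (@FGlL_inv R n B c O r).
Notation liftable := (@liftable R n B c r).
Notation K := [set` `[(0 : R), 1]].

Variables (U : set B) (eps : R).
Hypothesis UN : U `<=` N.
Hypothesis FGlL_lift : forall q, cube (2 * eps) q -> corn q ->
  exists2 z, U z & FGlL c z = q.
Variables (d d' : R) (dL : 'I_(n - 2) -> R).
Hypotheses (d_eps : 0 < d < eps) (d'_eps : 0 < d' < eps)
  (dL_eps : forall i, 0 < dL i < eps).
Notation C := (focus_box c U d d' dL).

Variables (x y : B).
Hypotheses (Cx : C x) (Cy : C y) (xy : x <> y).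

Let f := lerp (F x) (F y).
Let l i := lerp (L i x) (L i y).
(** [Gl] along the two candidates: [glow] makes [Gl] affine, while [gup] is an affine [Gr] minus the
    correction [k max(0, F)]. *)
Let glow := lerp (Gl x) (Gl y).
Let gup t := lerp (Gr x) (Gr y) t - k * Num.max 0 (f t).

Let Vx : V x. Proof. by case: Cx => /UN [+ _]. Qed.
Let Vy : V y. Proof. by case: Cy => /UN [+ _]. Qed.
Let k0 : 0 < k. Proof. exact: fc_index cf. Qed.

Let f_bound t : K t -> - d <= f t <= d.
Proof.
rewrite /= in_itv /= => t01; case: Cx => _ /andP[? ?] _ _ _.
by case: Cy => _ /andP[? ?] _ _ _; rewrite lerp_ge // lerp_le.
Qed.

Let l_bound t (i : 'I_(n - 2)) : K t ->
  (if (i < mc_e c)%N then 0 else - dL i) <= l i t <= dL i.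
Proof.
rewrite /= in_itv /= => t01; case: Cx => _ _ _ _ /(_ i) /andP[? ?].
by case: Cy => _ _ _ _ /(_ i) /andP[? ?]; rewrite lerp_ge // lerp_le.
Qed.

Let gup_glow t : K t -> glow t <= gup t.
Proof.
rewrite /= in_itv /= => t01; rewrite /gup /glow !(Gr_Gl cf) //.
have := max0_lerp (F x) (F y) t01; rewrite -(ler_pM2l k0) -/(f t) !lerpE.
by lra.
Qed.

Definition in_box (g : R -> R) :=
  forall t, K t -> - d' <= g t /\ g t + k * Num.max 0 (f t) <= d'.

(** Each candidate gets one bound by interpolation and the other by comparison through [gup_glow]:
    here the upper bound on [Gr], for [gup] the lower bound on [Gl]. *)
Let glow_box : in_box glow.
Proof.
move=> t Kt; have t01 : 0 <= t <= 1 by move: Kt; rewrite /= in_itv.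
case: Cx => _ _ mx Mx _; case: Cy => _ _ my My _; split; first exact: lerp_ge.
have := gup_glow Kt; have := lerp_le t01 Mx My; rewrite /gup; lra.
Qed.

Let gup_box : in_box gup.
Proof.
move=> t Kt; have t01 : 0 <= t <= 1 by move: Kt; rewrite /= in_itv.
case: Cx => _ _ mx Mx _; case: Cy => _ _ my My _; split.
  exact: le_trans (lerp_ge t01 mx my) (gup_glow Kt).
by rewrite subrK; exact: lerp_le.
Qed.

Let fc : continuous f. Proof. exact: lerp_continuous. Qed.
Let lc i : continuous (l i). Proof. exact: lerp_continuous. Qed.
Let glow_c : continuous glow. Proof. exact: lerp_continuous. Qed.

Let maxf_c : continuous (fun t => Num.max 0 (f t)).
Proof. by move=> t; apply: continuous_max; [exact: cvg_cst|exact: fc]. Qed.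

Let gup_c : continuous gup.
Proof.
move=> t; apply: cvgB; first exact: lerp_continuous.
by apply: cvgM; [exact: cvg_cst|exact: maxf_c].
Qed.

(** The factor 2 in [FGlL_lift] leaves this room: box coordinates are below [eps] in absolute value
    and the translation adds at most [eps]. The [L] coordinates, hence the elliptic conditions, are
    untouched. *)
Let lift g s a b t : in_box g -> K t -> 0 <= s <= 1 ->
  `|a| <= eps -> `|b| <= eps ->
  exists2 z, U z & FGlL c z = coords (f t + s * a) (g t + s * b) (l ^~ t).
Proof.
move=> gC Kt /andP[s0 s1]; rewrite !ler_norml => /andP[? ?] /andP[? ?].
have /andP[? ?] := f_bound Kt; have [? ?] := gC t Kt.
have m0 : 0 <= Num.max 0 (f t) by rewrite le_max lexx.
move: (d_eps) (d'_eps) => /andP[? ?] /andP[? ?].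
have km0 : 0 <= k * Num.max 0 (f t) by rewrite mulr_ge0 // ltW.
apply: FGlL_lift.
  rewrite /cube /=; elim/(@indexP _ n_ge3) => [||i]; rewrite coordsE ltr_norml.
  - by apply/andP; split; nra.
  - by apply/andP; split; nra.
  have /andP[lt0 ?] := l_bound i Kt; have /andP[? ?] := dL_eps i.
  have : - dL i <= l i t by move: lt0; case: ifP => // _; lra.
  by move=> ?; apply/andP; split; lra.
apply/(corner_coords n_ge3) => i ie.
by have /andP[+ _] := l_bound i Kt; rewrite ie.
Qed.

Let inv_lift p : (exists2 z, U z & FGlL c z = p) -> liftable p /\ U (inv p).
Proof.
case=> z Uz <-; split; first by exists z => //; exact: UN.
by rewrite (FGlL_invK n_ge3 cf cube_lift) //; exact: UN.
Qed.

Let lift0 g t : in_box g -> K t ->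
  exists2 z, U z & FGlL c z = coords (f t) (g t) (l ^~ t).
Proof.
move=> gC Kt; have eps0 : `|0 : R| <= eps.
  by rewrite normr0; move: d_eps => /andP[? ?]; lra.
have := lift gC Kt _ eps0 eps0 (s := 0).
by rewrite !mul0r !addr0 lexx ler01; exact.
Qed.

Let affine_shift (g : R -> R) (e : R) :
  affine_on_unit g -> affine_on_unit (fun t => g t + e).
Proof. by move=> [u [v gE]]; exists (u + e), v => t /gE ->; ring. Qed.

Let harmonic01 m : 0 <= (harmonic m : R) <= 1.
Proof. by rewrite /harmonic /= invr_ge0 ler0n invf_le1 ?ler1n ?ltr0n. Qed.

Definition joined := exists a b (gamma : R -> B),
  [/\ a < b, straight_line M `[a, b] gamma,
    gamma a = x, gamma b = y & gamma @` `[a, b] `<=` C].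

(** Reduces joining to checking which cut is avoided, by each translate and by the curve itself off
    the focus points. A translate that uses [Gr] keeps [F] fixed, because [Gr] involves
    [max(0, F)]. *)
Let box_line g a b : continuous g -> in_box g -> g 0 = Gl x -> g 1 = Gl y ->
  `|a| <= eps -> `|b| <= eps ->
  let gr t := g t + k * Num.max 0 (f t) in
  (forall m t z, K t -> N z -> F z = f t + harmonic m * a ->
    Gl z = g t + harmonic m * b -> (forall i, L i z = l i t) ->
    (left_domain c z /\ affine_on_unit g) \/
    [/\ right_domain c z, a = 0 & affine_on_unit gr]) ->
  (forall t z, K t -> N z -> F z = f t -> Gl z = g t ->
    (forall i, L i z = l i t) -> ~ (F z = 0 /\ H z = 0) ->
    (left_domain c z /\ affine_on_unit g) \/
    (right_domain c z /\ affine_on_unit gr)) ->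
  joined.
Proof.
move=> gc gC g0 g1 aeps beps gr reg_ reg.
pose gamma t := inv (coords (f t) (g t) (l ^~ t)).
have L0 t : K t -> liftable (coords (f t) (g t) (l ^~ t)).
  by move=> Kt; have [] := inv_lift (lift0 gC Kt).
have L_ m t : K t -> liftable
    (coords (f t + harmonic m * a) (g t + harmonic m * b) (l ^~ t)).
  by move=> Kt; have [] := inv_lift (lift gC Kt (harmonic01 m) aeps beps).
have fa : affine_on_unit f := lerp_affine _ _.
have la i : affine_on_unit (l i) := lerp_affine _ _.
have gamma0 : gamma 0 = x.
  rewrite -[RHS](FGlL_invK n_ge3 cf cube_lift) //; last by case: Cx => /UN.
  congr inv; apply/esym/(coords_eq (n_ge3 := n_ge3)) => [||i].
  - by rewrite (FGlLE n_ge3) /f lerp0.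
  - by rewrite (FGlLE n_ge3) g0.
  - by rewrite (FGlLE n_ge3) [l i 0]lerp0.
have gamma1 : gamma 1 = y.
  rewrite -[RHS](FGlL_invK n_ge3 cf cube_lift) //; last by case: Cy => /UN.
  congr inv; apply/esym/(coords_eq (n_ge3 := n_ge3)) => [||i].
  - by rewrite (FGlLE n_ge3) /f lerp1.
  - by rewrite (FGlLE n_ge3) g1.
  - by rewrite (FGlLE n_ge3) [l i 1]lerp1.
exists 0, 1, gamma; split=> //.
- apply: (shift_straight_line n_ge3 cf cube_lift fc gc lc L0 L_).
  + by rewrite -/(gamma 0) -/(gamma 1) gamma0 gamma1.
  + move=> m.
    have fc_ : continuous (fun t => f t + harmonic m * a).
      by move=> t; apply: cvgD; [exact: fc|exact: cvg_cst].
    have gc_ : continuous (fun t => g t + harmonic m * b).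
      by move=> t; apply: cvgD; [exact: gc|exact: cvg_cst].
    apply: (curve_regular n_ge3 cf cube_lift) => //.
    * exact: L_.
    * exact: affine_shift.
    * move=> t Kt.
      have [Nt eF eG eL _] := curveE n_ge3 cf cube_lift (L_ m) Kt.
      have [[dl ga]|[dr a0 [u [v gE]]]] := reg_ m t _ Kt Nt eF eG eL.
        by left; split=> //; exact: affine_shift.
      (* With [a = 0] the positive part is unchanged, so [Gr] only gains the constant
         [harmonic m * b]. *)
      right; split=> //; exists (u + harmonic m * b), v => s Ks.
      by rewrite a0 mulr0 addr0 addrAC -/(gr s) gE //; ring.
  + move=> nf; apply: (curve_regular n_ge3 cf cube_lift) => // t Kt.
    have [Nt eF eG eL _] := curveE n_ge3 cf cube_lift L0 Kt.
    by apply: (reg t) => //; exact: nf.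
- move=> _ [t Kt <-]; have [Nt eF eG eL eGr] := curveE n_ge3 cf cube_lift L0 Kt.
  have [lb ub] := gC t Kt.
  split.
  + by have [] := inv_lift (lift0 gC Kt).
  + by rewrite eF; exact: f_bound.
  + by rewrite eG.
  + by rewrite eGr.
  + by move=> i; rewrite eL; exact: l_bound.
Qed.

Let N_V z : N z -> V z. Proof. by case. Qed.

Let H_le z z' : N z -> N z' -> F z = F z' -> (forall i, L i z = L i z') ->
  Gl z <= Gl z' -> H z <= H z'.
Proof.
move=> Nz Nz' Fzz Lzz; apply: contraTT; rewrite -!ltNge.
exact: (Gl_lt n_ge3 cf cube_lift Nz' Nz).
Qed.

Let eps0 : 0 < eps. Proof. by move: d_eps => /andP[]; exact: lt_trans. Qed.

Let harmonic0 m : 0 < (harmonic m : R).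
Proof. by rewrite /harmonic /= invr_gt0 ltr0n. Qed.

(* On one side of the wall [F = 0] both branches are affine along the segment,
   and translating it away from the wall makes it avoid the focus points. *)
Let one_sided (s : R) : `|s| = 1 -> (forall t, K t -> 0 <= s * f t) ->
  affine_on_unit (fun t => glow t + k * Num.max 0 (f t)) -> joined.
Proof.
move=> s1 sf gra; have ga := lerp_affine (Gl x) (Gl y).
have ss : s * s = 1 by rewrite -[RHS](expr1n _ 2) -s1 real_normK ?num_real.
apply: (@box_line glow (s * eps) 0) => //.
- by rewrite /glow lerp0.
- by rewrite /glow lerp1.
- by rewrite normrM s1 mul1r ger0_norm // ltW.
- by rewrite normr0 ltW.
- move=> m t z Kt Nz Fz _ _; left; split=> //; split; first exact: N_V.
  (* As [s * s = 1], the product [s * F z] equals [s * f t + harmonic m * eps], which is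
     positive. *)
  move=> [F0 _]; have : s * F z = 0 by rewrite F0 mulr0.
  rewrite Fz mulrDr mulrCA (mulrA s) ss mul1r => e.
  by have := sf t Kt; have := mulr_gt0 (harmonic0 m) eps0; lra.
- move=> t z Kt Nz Fz _ _ nf; have Vz := N_V Nz.
  (* If [H z < 0], the left cut is avoided; if [0 <= H z], a point of the right cut would have
     [F = H = 0], which [nf] excludes. *)
  have [H0|H0] := ltP (H z) 0; first by left; split=> //; split=> // -[_]; lra.
  by right; split=> //; split=> // -[F0 H0']; apply: nf; split=> //; lra.
Qed.

(* The two candidates cross the wall at the same [L], the upper one with the
   larger [G]: it passes on the right of the focus points unless the lower one
   passes on their left. *)
Let two_sided : F x * F y < 0 -> joined.
Proof.
move=> Fxy; have Fn : F x - F y != 0.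
  by apply/eqP => e; move: Fxy; rewrite (subr0_eq e) -expr2; have := sqr_ge0 (F y); lra.
(* The only parameter at which [f] vanishes. *)
pose ts := F x / (F x - F y).
have tsE t : f t = 0 -> t = ts.
  by rewrite /f /lerp /ts => e; apply: (mulIf Fn); rewrite divfK //; lra.
have fts : f ts = 0 by rewrite /f /lerp /ts; field.
have ts01 : 0 < ts < 1.
  (* Multiplying by this square, positive whatever the sign of [F x - F y], gives polynomial
     inequalities that follow from [F x * F y < 0]. *)
  have Fn2 : 0 < (F x - F y) ^+ 2 by rewrite exprn_even_gt0.
  have e : ts * (F x - F y) = F x by rewrite divfK.
  have e1 : ts * (F x - F y) ^+ 2 = F x ^+ 2 - F x * F y by rewrite expr2 mulrA e; ring.
  have := sqr_ge0 (F x); have := sqr_ge0 (F y) => ? ?.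
  apply/andP; split; first by rewrite -(pmulr_lgt0 _ Fn2) e1; lra.
  by rewrite -(ltr_pM2r Fn2) e1 mul1r; nra.
have Kts : K ts by rewrite /= in_itv /=; case/andP: ts01 => /ltW-> /ltW->.
have [zl Ul el] := lift0 glow_box Kts.
have [zu Uu eu] := lift0 gup_box Kts.
have [Nl Nu] := (UN Ul, UN Uu).
have zlE : [/\ F zl = 0, Gl zl = glow ts & forall i, L i zl = l i ts].
  split=> [||i]; first by rewrite -(FGlLE n_ge3 zl).1.1 el coordsE.
  - by rewrite -(FGlLE n_ge3 zl).1.2 el coordsE.
  - by rewrite -(FGlLE n_ge3 zl).2 el coordsE.
have zuE : [/\ F zu = 0, Gl zu = gup ts & forall i, L i zu = l i ts].
  split=> [||i]; first by rewrite -(FGlLE n_ge3 zu).1.1 eu coordsE.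
  - by rewrite -(FGlLE n_ge3 zu).1.2 eu coordsE.
  - by rewrite -(FGlLE n_ge3 zu).2 eu coordsE.
case: zlE zuE => Fl Gll Ll [Fu Glu Lu].
have lu : H zl < H zu.
  apply: (H_lt n_ge3 cf cube_lift) => //; [by rewrite Fl|by move=> i; rewrite Ll|].
  rewrite Gll Glu /gup fts maxxx mulr0 subr0 /glow !(Gr_Gl cf) // !lerpE.
  (* The gap between the candidates at the wall is [k] times this combination; both weights are
     positive and so is one of [F x], [F y]. *)
  suff : 0 < (1 - ts) * Num.max 0 (F x) + ts * Num.max 0 (F y).
    by rewrite -(pmulr_rgt0 _ k0); lra.
  have mx : F x <= Num.max 0 (F x) by rewrite le_max lexx orbT.
  have my : F y <= Num.max 0 (F y) by rewrite le_max lexx orbT.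
  have mx0 : 0 <= Num.max 0 (F x) by rewrite le_max lexx.
  have my0 : 0 <= Num.max 0 (F y) by rewrite le_max lexx.
  case/andP: ts01 => t0 t1; have [Fx0|Fx0] := leP (F x) 0; last by nra.
  have Fy0 : 0 < F y by nra.
  by nra.
have [Hl|Hl] := leP (H zl) 0.
(* The lower candidate meets the wall at [zl] with [H zl <= 0]; lowering [G] makes [H] negative
   there, so the translates avoid the left cut. *)
- apply: (@box_line glow 0 (- eps)) => //; rewrite ?normr0 ?normrN //.
  + exact: lerp0.
  + exact: lerp1.
  + exact: ltW.
  + by rewrite ger0_norm // ltW.
  + move=> m t z Kt Nz; rewrite mulr0 addr0 => Fz Gz Lz; left.
    split; last exact: lerp_affine.
    split; first exact: N_V.
    move=> [F0 H0]; have tt : t = ts by apply: tsE; rewrite -Fz.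
    have : H z < H zl.
      apply: (H_lt n_ge3 cf cube_lift) => //; [by rewrite Fl|by move=> i; rewrite Lz Ll tt|].
      by rewrite Gz Gll tt; have := mulr_gt0 (harmonic0 m) eps0; lra.
    by lra.
  + move=> t z Kt Nz Fz Gz Lz nf; left.
    split; last exact: lerp_affine.
    split; first exact: N_V.
    move=> [F0 H0]; have tt : t = ts by apply: tsE; rewrite -Fz.
    (* A point of the left cut has [0 <= H z], while [H z <= H zl <= 0]: it would be a focus
       point. *)
    apply: nf; split=> //.
    have : H z <= H zl.
      apply: H_le => //; [by rewrite Fl|by move=> i; rewrite Lz Ll tt|].
      by rewrite Gz Gll tt.
    by lra.
- have gra : affine_on_unit (fun t => gup t + k * Num.max 0 (f t)).
    have [u [v uE]] := lerp_affine (Gr x) (Gr y).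
    by exists u, v => t Kt; rewrite subrK uE.
  have right z t : N z -> f t = 0 -> F z = 0 -> gup ts <= Gl z ->
      (forall i, L i z = l i t) -> 0 < H z.
    move=> Nz ft Fz Gz Lz; apply: (lt_le_trans (lt_trans Hl lu)).
    apply: H_le => //; [by rewrite Fz|by move=> i; rewrite Lz Lu (tsE t)|].
    by rewrite Glu.
  (* Now [0 < H zl < H zu], so the upper candidate and its upward translates have [H > 0] on the
     wall and stay in the right domain. *)
  apply: (@box_line gup 0 eps) => //.
  + by rewrite /gup lerp0 /f lerp0 (Gr_Gl cf) // addrK.
  + by rewrite /gup lerp1 /f lerp1 (Gr_Gl cf) // addrK.
  + by rewrite normr0 ltW.
  + by rewrite ger0_norm // ltW.
  + move=> m t z Kt Nz; rewrite mulr0 addr0 => Fz Gz Lz; right; split=> //.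
    split; first exact: N_V.
    move=> [F0 H0]; have ft : f t = 0 by rewrite -Fz.
    have : 0 < H z.
      apply: (right z t) => //; rewrite Gz (tsE t ft).
      by have := mulr_gt0 (harmonic0 m) eps0; lra.
    by lra.
  + move=> t z Kt Nz Fz Gz Lz nf; right; split=> //.
    split; first exact: N_V.
    move=> [F0 H0]; have ft : f t = 0 by rewrite -Fz.
    have : 0 < H z by apply: (right z t) => //; rewrite Gz (tsE t ft).
    by lra.
Qed.

Lemma box_joined : joined.
Proof.
have K01 t : K t -> 0 <= t <= 1 by rewrite /= in_itv.
have [Fxy|Fxy] := ltP (F x * F y) 0; first exact: two_sided.
have [[Fx Fy]|[Fx Fy]] : F x <= 0 /\ F y <= 0 \/ 0 <= F x /\ 0 <= F y.
  have [Fx|Fx] := ltP (F x) 0; first by left; split; nra.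
  by have [Fy|Fy] := ltP (F y) 0; [left; split; nra|right].
- have f0 t : K t -> f t <= 0 by move=> /K01 t01; exact: lerp_le.
  apply: (@one_sided (-1)); first by rewrite normrN1.
    by move=> t /f0; lra.
  have [u [v uE]] := lerp_affine (Gl x) (Gl y).
  by exists u, v => t Kt; rewrite (max_idPl (f0 t Kt)) mulr0 addr0 -uE.
- have f0 t : K t -> 0 <= f t by move=> /K01 t01; exact: lerp_ge.
  apply: (@one_sided 1); first by rewrite normr1.
    by move=> t /f0; lra.
  (* For [F >= 0] the positive part is [F] itself, so [Gr] is the interpolation of [Gl + k F]; these
     are its initial value and slope. *)
  exists (Gl x + k * F x), (Gl y - Gl x + k * (F y - F x)) => t Kt.
  by rewrite (max_idPr (f0 t Kt)) /glow /f /lerp; ring.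
Qed.

End FocusBox.

(** * Choice of the neighbourhood of [O] and of the bound on the box sizes *)

Theorem theorem7p3 (R : realType) (n : nat) (n_ge3 : (3 <= n)%N)
    (B : uniformType) (M : singular_affine_manifold R n B) (O : B)
    (c : multivalued_coords R n B)
    (O_focus : focus_points M O) (c_focus : focus_coordinates M c O)
    (F_O : mc_F c O = 0) (G_O : mc_Gl c O = 0)
    (L_O : forall i, mc_L c i O = 0) :
  exists U0 : set B, [/\ nbhs O U0, U0 `<=` mc_V c &
    forall U : set B, nbhs O U -> U `<=` U0 ->
      exists2 eps : R, 0 < eps &
        forall (d d' : R) (dL : 'I_(n - 2) -> R),
          0 < d < eps -> 0 < d' < eps -> (forall i, 0 < dL i < eps) ->
          affinely_convex M (focus_box c U d d' dL)].
Proof.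
have VO := fc_nbhs c_focus.
(* [H] vanishes at [O] because [O] is a focus point and the focus points in [V] are the common zeros
   of [F] and [H]. *)
have H_O : mc_H c O = 0.
  suff [_ []] : (mc_V c `&` [set x | mc_F c x = 0 /\ mc_H c x = 0]) O by [].
  by rewrite -(fc_focus c_focus).
have FHL_O j : FHL c O 0 j = 0.
  by elim/(@indexP _ n_ge3): j => [||i]; rewrite (FHLE n_ge3).
have FGlL_O j : FGlL c O 0 j = 0.
  by elim/(@indexP _ n_ge3): j => [||i]; rewrite (FGlLE n_ge3).
have [r r0 hr] := near_row (FHL_image c_focus VO filterT).
have cube_lift q : cube r q -> corner R n (elliptic_indices c) q ->
    exists2 z, mc_V c z & FHL c z = q.
  move=> qr cq; have [j|//|z [Vz _ ez]] := hr q; last by exists z.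
  by rewrite FHL_O sub0r normrN; exact: qr.
have NO : focus_nbhd (c := c) r O by split=> // j; rewrite FHL_O normr0.
exists (focus_nbhd (c := c) r); split; first exact: (focus_nbhd_nbhs c_focus).
  by move=> z [].
move=> U nU UN; have [e e0 he] := near_row (FGlL_open n_ge3 c_focus VO nU).
(* [box_joined] requires lifting a cube of size [2 * eps]; this is [e], the size up to which [FGlL]
   has preimages in [U]. *)
exists (e / 2); first lra.
move=> d d' dL d_eps d'_eps dL_eps x y Cx Cy xy.
apply: (box_joined n_ge3 c_focus cube_lift UN _ d_eps d'_eps dL_eps Cx Cy xy).
move=> q qe cq; have [j||z [_ Uz] ez] := he q => //; last by exists z.
by have := qe j; rewrite FGlL_O sub0r normrN; lra.
Qed.
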